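(* Let $f\in L^1(\mathbb{R})$ be a nonnegative density, let $T_f$ be the induced tempered distribution, and let $\varphi\in\mathcal{S}(\mathbb{R})$ with $\varphi\ge0$. For $a\in\mathbb{R}$ define $$F_\varphi(a):=\int_{-\infty}^a f(x)\varphi(x)\,dx.$$ If $(\psi_n)_{n\ge1}\subset\mathcal{S}(\mathbb{R})$ satisfies $0\le\psi_n\le1$ and $\psi_n(x)\to\mathbf{1}_{(-\infty,a)}(x)$ for every $x\in\mathbb{R}$, then $$\mathbb{E}_{T_f,\varphi}[\psi_n]\longrightarrow F_\varphi(a)\qquad(n\to\infty).$$ In particular, the weak expectation determines $F_\varphi$: if two nonnegative densities in $L^1(\mathbb{R})$ have the same weak expectations with respect to $\varphi$ for all $\psi\in\mathcal{S}(\mathbb{R})$, then their kernel-weighted distribution functions $F_\varphi$ coincide.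
   Context: $\mathcal{S}(\mathbb{R})$ is the Schwartz space. For a tempered distribution $T$ and $\varphi\in\mathcal{S}(\mathbb{R})$, the weak expectation of a function $\psi$ with $\psi\varphi\in\mathcal{S}(\mathbb{R})$ is $\mathbb{E}_{T,\varphi}[\psi]:=\langle T,\psi\varphi\rangle$; for $T=T_f$ this is $\int_{\mathbb{R}} f\psi\varphi\,dx$. *)

(* Defs.v *)
From HB Require Import structures.
From mathcomp Require Import all_boot all_order all_algebra.
From mathcomp Require Import all_classical all_reals all_analysis.
From mathcomp Require Import measurable_realfun.
Set Implicit Arguments.
Unset Strict Implicit.
Unset Printing Implicit Defensive.
Import Order.TTheory GRing.Theory Num.Theory.
Import numFieldNormedType.Exports.
Local Open Scope classical_set_scope.
Local Open Scope ring_scope.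

(* In [ring_scope] these notations denote derivatives of polynomials. *)
Local Notation "f ^` ()" := (derive1 f) : ring_scope.
Local Notation "f ^` ( n )" := (derive1n n f) : ring_scope.

Definition smooth {R : realType} (g : R -> R) : Prop :=
  forall (n : nat) (x : R), derivable g^`(n) x 1.

Definition rapidly_decreasing {R : realType} (g : R -> R) : Prop :=
  forall m n : nat, exists C : R, forall x : R, `|x ^+ m * g^`(n) x| <= C.

Definition schwartz {R : realType} : {pred R -> R} :=
  mem [set g : R -> R | smooth g /\ rapidly_decreasing g].

Section SchwartzClosure.
Variable R : realType.
Implicit Types f g : R -> R.

Lemma schwartzP g :
  reflect (smooth g /\ rapidly_decreasing g) (g \in @schwartz R).
Proof. by apply: (iffP idP) => [/[!inE]|] //; rewrite inE. Qed.

Lemma smooth_derive1 g : smooth g -> smooth g^`().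
Proof. by move=> sg n x; rewrite -derive1Sn; exact: sg. Qed.

Lemma derivable_smooth g x : smooth g -> derivable g x 1.
Proof. by move=> /(_ 0%N x). Qed.

Lemma derive1M f g : smooth f -> smooth g ->
  (f \* g)^`() = (f \* g^`()) \+ (g \* f^`()).
Proof.
move=> sf sg; apply/funext => x.
rewrite derive1E deriveM; [by rewrite /= !derive1E| |]; exact: derivable_smooth.
Qed.

Lemma derive1Z (a : R) f : smooth f -> (a \*: f)^`() = a \*: f^`().
Proof.
move=> sf; apply/funext => x.
rewrite derive1E deriveZ; [by rewrite /= !derive1E|]; exact: derivable_smooth.
Qed.

Lemma derive1nD n f g :
  (forall k x, (k < n)%N -> derivable f^`(k) x 1) ->
  (forall k x, (k < n)%N -> derivable g^`(k) x 1) ->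
  (f \+ g)^`(n) = f^`(n) \+ g^`(n).
Proof.
elim: n => [|n IH] // df dg; rewrite !derive1nS IH; last 2 first.
- by move=> k x kn; apply: df; exact: ltnW.
- by move=> k x kn; apply: dg; exact: ltnW.
apply/funext => x; rewrite derive1E deriveD; first by rewrite /= !derive1E.
  exact: df.
exact: dg.
Qed.

Lemma derive1nZ n (a : R) f : smooth f -> (a \*: f)^`(n) = a \*: f^`(n).
Proof.
elim: n f => [|n IH] f sf //.
by rewrite !derive1Sn derive1Z// IH// => k x; rewrite -derive1Sn; exact: sf.
Qed.

Lemma schwartzD f g :
  f \in schwartz -> g \in schwartz -> f \+ g \in @schwartz R.
Proof.
move=> /schwartzP[sf rf] /schwartzP[sg rg]; apply/schwartzP; split => [n x|m n].
  by rewrite derive1nD//; apply: derivableD; [exact: sf|exact: sg].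
have [A Af] := rf m n; have [B Bg] := rg m n.
exists (A + B) => x; rewrite derive1nD//= mulrDr.
by rewrite (le_trans (ler_normD _ _))// lerD.
Qed.

Lemma schwartzZ (a : R) f : f \in schwartz -> a \*: f \in @schwartz R.
Proof.
move=> /schwartzP[sf rf]; apply/schwartzP; split => [n x|m n].
  by rewrite derive1nZ//; apply: derivableZ; exact: sf.
have [A Af] := rf m n; exists (`|a| * A) => x; rewrite derive1nZ//=.
by rewrite /GRing.scale/= mulrCA normrM ler_wpM2l.
Qed.

Lemma schwartz0 : (0 : R -> R) \in schwartz.
Proof.
have E n : (0 : R -> R)^`(n) = 0.
  by elim: n => // n IH; rewrite derive1nS IH; apply/funext => x; exact: derive1_cst.
apply/schwartzP; split => [n x|m n].
  by rewrite E; exact: derivable_cst.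
by exists 0 => x; rewrite E /= mulr0 normr0.
Qed.

Lemma schwartz_smooth g : g \in schwartz -> smooth g.
Proof. by move=> /schwartzP[]. Qed.

Lemma schwartz_derive1 g : g \in schwartz -> g^`() \in @schwartz R.
Proof.
move=> /schwartzP[sg rg]; apply/schwartzP.
by split=> [|m n]; [exact: smooth_derive1|rewrite -derive1Sn; exact: rg].
Qed.

Lemma smoothM f g : smooth f -> smooth g -> smooth (f \* g).
Proof.
have H n : forall f g, smooth f -> smooth g ->
    forall k x, (k < n)%N -> derivable (f \* g)^`(k) x 1.
  elim: n => // n IH {}f {}g sf sg [|k] x; rewrite ltnS => kn.
    by apply: derivableM; exact: derivable_smooth.
  have [sf' sg'] := (smooth_derive1 sf, smooth_derive1 sg).
  rewrite derive1Sn derive1M// derive1nD.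
  - by apply: derivableD; exact: IH.
  - by move=> i y ik; apply: IH => //; exact: ltn_trans kn.
  - by move=> i y ik; apply: IH => //; exact: ltn_trans kn.
by move=> sf sg n x; exact: (H n.+1).
Qed.

Lemma schwartzM f g :
  f \in schwartz -> g \in schwartz -> f \* g \in @schwartz R.
Proof.
have H n : forall f g, f \in @schwartz R -> g \in @schwartz R ->
    forall m, exists C : R, forall x, `|x ^+ m * (f \* g)^`(n) x| <= C.
  elim: n => [|n IH] {}f {}g fS gS m.
    have /schwartzP[_ /(_ m 0%N)[A Af]] := fS.
    have /schwartzP[_ /(_ 0%N 0%N)[B Bg]] := gS.
    exists (A * B) => x; rewrite /= mulrA normrM.
    by apply: ler_pM => //; have := Bg x; rewrite mul1r.
  have [sf sg] := (schwartz_smooth fS, schwartz_smooth gS).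
  have [A Af] := IH _ _ fS (schwartz_derive1 gS) m.
  have [B Bg] := IH _ _ gS (schwartz_derive1 fS) m.
  exists (A + B) => x; rewrite derive1Sn derive1M// derive1nD.
  - by rewrite mulrDr (le_trans (ler_normD _ _))// lerD.
  - by move=> k y _; apply: smoothM => //; exact: smooth_derive1.
  - by move=> k y _; apply: smoothM => //; exact: smooth_derive1.
move=> fS gS; apply/schwartzP; split => [|m n]; last exact: H.
by apply: smoothM; exact: schwartz_smooth.
Qed.

End SchwartzClosure.

Section SchwartzSpace.
Variable R : realType.

Lemma schwartz_submod_closed : submod_closed (@schwartz R).
Proof.
split=> [|a f g fS gS]; first exact: schwartz0.
by apply: schwartzD => //; exact: schwartzZ.
Qed.

HB.instance Definition _ :=
  GRing.isSubmodClosed.Build _ _ (@schwartz R) schwartz_submod_closed.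

Record schwartzSpace := SchwartzFun {
  schwartz_fun :> R -> R;
  schwartz_funP : schwartz_fun \in @schwartz R }.

HB.instance Definition _ := [isSub for schwartz_fun].
HB.instance Definition _ := [Choice of schwartzSpace by <:].
HB.instance Definition _ := [SubChoice_isSubLmodule of schwartzSpace by <:].

Definition schwartz_seminorm (m n : nat) (g : schwartzSpace) : R :=
  sup (range (fun x : R => `|x ^+ m * g^`(n) x|)).

(* Continuity for the Frechet topology of the family of seminorms. *)
Definition schwartz_continuous (T : schwartzSpace -> R) : Prop :=
  forall (g : schwartzSpace) (e : R), 0 < e ->
  exists (N : nat) (d : R), 0 < d /\
    forall h : schwartzSpace,
      (forall m n : nat, (m <= N)%N -> (n <= N)%N ->
         schwartz_seminorm m n (h - g) < d) ->
      `|T h - T g| < e.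

Record temperedDistribution := TemperedDistribution {
  tempered_fun :> {scalar schwartzSpace};
  tempered_cont : schwartz_continuous tempered_fun }.

End SchwartzSpace.

Section WeakExpectation.
Variable R : realType.
Local Notation mu := (@lebesgue_measure R).

Definition regular_fun (f : R -> R) (g : schwartzSpace R) : R :=
  \int[mu]_x (f x * g x).

Lemma schwartz_seminorm_ge m n (g : schwartzSpace R) x :
  `|x ^+ m * g^`(n) x| <= schwartz_seminorm m n g.
Proof.
have /schwartzP[_ /(_ m n)[C Cg]] := schwartz_funP g.
apply: ub_le_sup; last by exists x.
by exists C => _ [y _ <-]; exact: Cg.
Qed.

Lemma schwartz_bounded (g : schwartzSpace R) x :
  `|g x| <= schwartz_seminorm 0 0 g.
Proof. by have := schwartz_seminorm_ge 0 0 g x; rewrite mul1r. Qed.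

Lemma schwartz_measurable (g : schwartzSpace R) : measurable_fun setT g.
Proof.
apply: continuous_measurable_fun => x.
apply: differentiable_continuous; apply/derivable1_diffP.
exact/derivable_smooth/schwartz_smooth/schwartz_funP.
Qed.

Lemma integrable_regular (f : R -> R) (g : schwartzSpace R) :
  f \in Lfun mu 1 -> mu.-integrable setT (EFin \o (f \* g)).
Proof.
move=> /Lfun1_integrable fi; rewrite (_ : _ \o _ = (EFin \o (g \* f))); last first.
  by apply/funext => x /=; rewrite mulrC.
have fm : measurable_fun setT f.
  by apply/measurable_EFinP; exact: (measurable_int mu).
apply: (@le_integrable _ _ _ mu setT measurableT _
  (fun x => (schwartz_seminorm 0 0 g)%:E * (EFin \o f) x)%E).
- apply/measurable_EFinP; apply: measurable_funM => //; exact: schwartz_measurable.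
- move=> x _; rewrite /= lee_fin !normrM ler_wpM2r//.
  by rewrite (le_trans (schwartz_bounded g x))// ler_norm.
- exact: integrableZl.
Qed.

Lemma regular_linear (f : R -> R) : f \in Lfun mu 1 -> scalar (regular_fun f).
Proof.
move=> fL a g h; rewrite /regular_fun.
rewrite -RintegralZl//; last exact: integrable_regular.
rewrite -RintegralD//.
- by apply: eq_Rintegral => x _; rewrite /= mulrDr mulrCA.
- exact: (integrableZl measurableT a (integrable_regular g fL)).
- exact: integrable_regular.
Qed.

Lemma regular_continuous (f : R -> R) :
  f \in Lfun mu 1 -> schwartz_continuous (regular_fun f).
Proof.
move=> fL g e e0.
have fi : mu.-integrable setT (EFin \o f) by exact/Lfun1_integrable.
have nfi : mu.-integrable setT (EFin \o (fun x => `|f x|)).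
  exact: integrable_norm.
pose c := \int[mu]_x `|f x|.
have c0 : 0 <= c by exact: Rintegral_ge0.
have c1 : 0 < c + 1 by rewrite ltr_wpDl.
exists 0%N, (e / (c + 1)); split=> [|h /(_ 0 0 (leqnn _) (leqnn _))%N hg].
  exact: divr_gt0.
have -> : regular_fun f h - regular_fun f g = regular_fun f (h - g).
  rewrite /regular_fun -RintegralB//; [|exact: integrable_regular..].
  by apply: eq_Rintegral => x _; rewrite /= mulrBr.
apply: (le_lt_trans (le_normr_Rintegral measurableT (integrable_regular _ fL))).
apply: (@le_lt_trans _ _ (\int[mu]_x (e / (c + 1) * `|f x|))).
  apply: le_Rintegral => //.
  - exact/integrable_norm/(integrable_regular (h - g) fL).
  - exact: (integrableZl measurableT (e / (c + 1)) nfi).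
  - move=> x _; rewrite normrM mulrC ler_wpM2r//.
    exact/ltW/(le_lt_trans (schwartz_bounded _ x)).
rewrite RintegralZl// -/c -mulrA -[ltRHS]mulr1 ltr_pM2l//.
by rewrite mulrC ltr_pdivrMr// mul1r ltrDl.
Qed.

(* T_f for f in L^1, as a tempered distribution. *)
Section RegularDistribution.
Variables (f : R -> R) (fL : f \in Lfun mu 1).

#[local] HB.instance Definition _ := GRing.isLinear.Build R (schwartzSpace R) R _
  (regular_fun f) (regular_linear fL).

Definition regular_distribution : temperedDistribution R :=
  TemperedDistribution (regular_continuous fL).

Lemma regular_distributionE (g : schwartzSpace R) :
  regular_distribution g = \int[mu]_x (f x * g x).
Proof. by []. Qed.

End RegularDistribution.

(* E_{T,phi}[psi] = <T, psi phi>, for any psi such that psi phi is Schwartz. *)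
Definition weak_expectation (T : temperedDistribution R) (phi : schwartzSpace R)
    (psi : R -> R) (psi_phi : psi \* phi \in @schwartz R) : R :=
  T (SchwartzFun psi_phi).

Definition schwartz_weak_expectation (T : temperedDistribution R)
    (phi psi : schwartzSpace R) : R :=
  weak_expectation T (schwartzM (schwartz_funP psi) (schwartz_funP phi)).

Definition weighted_cdf (f phi : R -> R) (a : R) : R :=
  \int[mu]_(x in `]-oo, a]) (f x * phi x).

End WeakExpectation.

(* Main.v *)
Require Import Defs.
From HB Require Import structures.
From mathcomp Require Import all_boot all_order all_algebra.
From mathcomp Require Import all_classical all_reals all_analysis.
From mathcomp Require Import measurable_realfun ring lra.
Set Implicit Arguments.
Unset Strict Implicit.
Unset Printing Implicit Defensive.
Import Order.TTheory GRing.Theory Num.Theory.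
Import numFieldNormedType.Exports.
Local Open Scope classical_set_scope.
Local Open Scope ring_scope.

(** The convergence is dominated convergence: the integrand is dominated by
    |f phi|, and the endpoint a is negligible.  For the determinacy claim it
    then suffices to exhibit one admissible sequence of Schwartz windows for
    each a.  We take doubly exponential functions
    w(x) = exp (- e^(b x + c) - e^(d - x)) with b > 0: the span of the
    functions e^(k x) w(x), k real, is stable under differentiation, and each
    of them decays faster than any power of x in both directions. *)

(** Once a class is stable under differentiation, every iterated derivative stays in it, so decay of
    the members themselves suffices and no formula for the n-th derivative is needed. *)
Lemma schwartz_derive1_stable (R : realType) (A : set (R -> R)) :
  (forall f, A f -> forall x, derivable f x 1) ->
  (forall f, A f -> A (derive1 f)) ->
  (forall f, A f -> forall m, exists C : R, forall x, `|x ^+ m * f x| <= C) ->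
  forall f, A f -> f \in @schwartz R.
Proof.
move=> dA A' bA f Af.
have An n : A (derive1n n f) by elim: n => // n IH; rewrite derive1nS; exact: A'.
by apply/schwartzP; split => [n x|m n]; [exact: dA|exact: bA].
Qed.

(* The slope at [ln k] of the convex function [expR] is [k]. *)
Lemma ler_linear_expR (R : realType) (k t : R) : 0 < k ->
  k * t <= expR t + (k * ln k - k).
Proof.
move=> k0; have := expR_ge1Dx (t - ln k).
rewrite expRB lnK ?posrE// ler_pdivlMr//; nra.
Qed.

(** * Doubly exponential Schwartz windows and their limit *)

Section GumbelWindow.
Variables (R : realType) (b c d : R).

(** The factor exp (- e^(d - x)) is the Gumbel distribution function with location [d] and removes
    the left tail; for [b > 0] the other factor, a reflected Gumbel law, cuts off to the right of -
    c / b. *)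
Definition gumbel_window (x : R) : R := expR (- expR (b * x + c) - expR (d - x)).

Definition expR_gumbel (k x : R) : R := expR (k * x) * gumbel_window x.

Lemma gumbel_window_itv x : 0 <= gumbel_window x <= 1.
Proof.
rewrite expR_ge0/= -expR0 ler_expR.
have := expR_ge0 (b * x + c); have := expR_ge0 (d - x); lra.
Qed.

Lemma expR_gumbel_ge0 k x : 0 <= expR_gumbel k x.
Proof. by rewrite mulr_ge0 ?expR_ge0. Qed.

Lemma is_derive_expR_gumbel (k x : R) : is_derive x 1 (expR_gumbel k)
  (k * expR_gumbel k x - b * expR c * expR_gumbel (k + b) x
   + expR d * expR_gumbel (k - 1) x).
Proof.
(* One affine rule serves all three exponentials, which is why [E] below writes k y + 0 and -1 y +
   d. *)
have elin u v : is_derive x 1 (fun y : R => expR (u * y + v)) (u * expR (u * x + v)).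
  have lin : is_derive x 1 (fun y : R => u * y + v) u.
    have -> : (fun y : R => u * y + v) = u \*: id + cst v by [].
    by apply: is_derive_eq; rewrite addr0 scaler1.
  have := @is_derive1_comp R expR (fun y => u * y + v) x _ _ (is_derive_expR _) lin.
  by rewrite mulrC.
have E : expR_gumbel k = (fun y : R => expR (k * y + 0)) *
    (expR \o (- (fun y : R => expR (b * y + c)) - (fun y : R => expR (-1 * y + d)))).
  apply/funext => y; rewrite /expR_gumbel /gumbel_window !fctE/=.
  by rewrite addr0 mulN1r [- y + d]addrC.
have := is_deriveB (is_deriveN (elin b c)) (elin (-1) d).
move=> /(is_derive1_comp (is_derive_expR _)) /(is_deriveM (elin k 0)).
rewrite -E => /is_derive_eq; apply.
rewrite /expR_gumbel !fctE /= addr0 /GRing.scale/= !mulN1r [- x + d]addrC.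
rewrite -/(gumbel_window x) !mulrDl mulN1r !expRD.
move: (gumbel_window x) (expR (k * x)) (expR (b * x)) (expR c) (expR d) (expR (- x)).
by move=> *; ring.
Qed.

Lemma expR_gumbel_bounded k : 0 < b ->
  exists C : R, forall x, expR_gumbel k x <= C.
Proof.
move=> b0; suff [C HC] : exists C : R, forall x,
    k * x <= expR (b * x + c) + expR (d - x) + C.
  exists (expR C) => x; rewrite /expR_gumbel -expRD ler_expR.
  by have := HC x; lra.
(* The linear term is absorbed by the exponential growing on its side: e^(d - x), with slope - k,
   when k < 0, and e^(b x + c), with slope k / b, when k > 0. *)
have [k0|k0|->] := ltgtP k 0.
- exists (k * d + (- k * ln (- k) + k)) => x.
  have kN : 0 < - k by rewrite oppr_gt0.
  have := @ler_linear_expR R (- k) (d - x) kN.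
  have := expR_ge0 (b * x + c); lra.
- have kb : 0 < k / b by rewrite divr_gt0.
  exists (k / b * ln (k / b) - k / b - k / b * c) => x.
  have := ler_linear_expR (b * x + c) kb; have := expR_ge0 (d - x).
  have -> : k / b * (b * x + c) = k * x + k / b * c by field; rewrite gt_eqF.
  lra.
- exists 0 => x; rewrite mul0r.
  by have := expR_ge0 (b * x + c); have := expR_ge0 (d - x); lra.
Qed.

(** Since |x| <= e^x + e^(-x), each power of x is traded for shifts of [k] by 1 and -1; hence the
    induction on [m] keeps [k] general. *)
Lemma expR_gumbel_rapid m k : 0 < b ->
  exists C : R, forall x, `|x ^+ m * expR_gumbel k x| <= C.
Proof.
move=> b0; elim: m k => [|m IH] k.
  have [C HC] := expR_gumbel_bounded k b0.
  by exists C => x; rewrite mul1r ger0_norm ?expR_gumbel_ge0.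
have [C1 H1] := IH (k + 1); have [C2 H2] := IH (k - 1).
exists (C1 + C2) => x; apply: le_trans (lerD (H1 x) (H2 x)).
rewrite exprSr -mulrA !(normrM (x ^+ m)) -mulrDr ler_wpM2l// (normrM x).
rewrite ![ `|expR_gumbel _ _| ]ger0_norm ?expR_gumbel_ge0//.
have -> : expR_gumbel (k + 1) x + expR_gumbel (k - 1) x =
    (expR x + expR (- x)) * expR_gumbel k x.
  by rewrite /expR_gumbel !mulrDl mulN1r mul1r !expRD; ring.
rewrite ler_wpM2r ?expR_gumbel_ge0// ler_norml.
have := expR_ge1Dx x; have := expR_ge1Dx (- x).
have := expR_ge0 x; have := expR_ge0 (- x); lra.
Qed.

(** The linear span is given by its closure rules rather than by finite sums, so that each stability
    property is a three-case induction. *)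
Inductive gumbel_span : (R -> R) -> Prop :=
| gumbel_span_exp k : gumbel_span (expR_gumbel k)
| gumbel_spanD f g : gumbel_span f -> gumbel_span g -> gumbel_span (f + g)
| gumbel_spanZ (u : R) f : gumbel_span f -> gumbel_span (u *: f).

Lemma gumbel_span_derivable f : gumbel_span f -> forall x, derivable f x 1.
Proof.
elim=> [k|{}f g _ df _ dg|u {}f _ df] x.
- by have [] := is_derive_expR_gumbel k x.
- exact: derivableD.
- exact: derivableZ.
Qed.

Lemma gumbel_span_derive1 f : gumbel_span f -> gumbel_span (derive1 f).
Proof.
elim=> [k|{}f g Af A'f Ag A'g|u {}f Af A'f].
- have -> : derive1 (expR_gumbel k) = k *: expR_gumbel k +
      (- (b * expR c)) *: expR_gumbel (k + b) + expR d *: expR_gumbel (k - 1).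
    apply/funext => x; rewrite derive1E.
    have [_ ->] := is_derive_expR_gumbel k x.
    by rewrite !fctE /GRing.scale/= mulNr.
  have spanZexp u l : gumbel_span (u *: expR_gumbel l).
    exact/gumbel_spanZ/gumbel_span_exp.
  exact: gumbel_spanD (gumbel_spanD (spanZexp _ _) (spanZexp _ _)) (spanZexp _ _).
- have -> : derive1 (f + g) = derive1 f + derive1 g.
    apply/funext => x; rewrite derive1E deriveD ?fctE -?derive1E//;
      exact: gumbel_span_derivable.
  exact: gumbel_spanD.
- have -> : derive1 (u *: f) = u *: derive1 f.
    apply/funext => x; rewrite derive1E deriveZ ?fctE -?derive1E//.
    exact: gumbel_span_derivable.
  exact: gumbel_spanZ.
Qed.

Lemma gumbel_span_rapid f : 0 < b -> gumbel_span f ->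
  forall m, exists C : R, forall x, `|x ^+ m * f x| <= C.
Proof.
move=> b0; elim=> [k|{}f g _ Bf _ Bg|u {}f _ Bf] m.
- exact: expR_gumbel_rapid.
- have [C HC] := Bf m; have [D HD] := Bg m.
  exists (C + D) => x; rewrite fctE mulrDr.
  by rewrite (le_trans (ler_normD _ _))// lerD.
- have [C HC] := Bf m; exists (`|u| * C) => x.
  by rewrite fctE /GRing.scale/= mulrCA normrM ler_wpM2l.
Qed.

Lemma gumbel_window_schwartz : 0 < b -> gumbel_window \in @schwartz R.
Proof.
move=> b0; apply: (@schwartz_derive1_stable R gumbel_span).
- exact: gumbel_span_derivable.
- exact: gumbel_span_derive1.
- by move=> f; exact: gumbel_span_rapid.
- have -> : gumbel_window = expR_gumbel 0.
    by apply/funext => x; rewrite /expR_gumbel mul0r expR0 mul1r.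
  exact: gumbel_span_exp.
Qed.

End GumbelWindow.

(* The window is [exp (- exp (N (N (x - a) + 1)) - exp (- x - N))] with
   [N = n + 1]; the summand [1] makes it vanish in the limit at [x = a] too. *)
Lemma cvg_gumbel_window (R : realType) (a x : R) :
  gumbel_window (n.+1%:R ^+ 2) (n.+1%:R * (1 - n.+1%:R * a)) (- n.+1%:R) x
    @[n --> \oo] --> (\1_`]-oo, a[ x : R).
Proof.
have e0 : expR (- n.+1%:R) @[n --> \oo] --> (0 : R).
  by rewrite (cvg_shiftS (fun n => expR (- n%:R) : R)); exact: cvgn_expR.
(* In this form, with N = n + 1, the exponent is at most - N for large N if x < a, and at least N if
   x >= a. *)
have argE n : n.+1%:R ^+ 2 * x + n.+1%:R * (1 - n.+1%:R * a) =
    n.+1%:R * (1 + n.+1%:R * (x - a)) :> R by ring.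
rewrite indicE; have [xa|ax] := ltP x a.
  rewrite mem_set/= ?in_itv//=.
  (* The limit 1 is written so that both inner exponentials tend to 0 and continuity of [expR]
     applies. *)
  have -> : true%:R = expR (- 0 - expR (- x) * 0) :> R.
    by rewrite mulr0 subr0 oppr0 expR0.
  apply: continuous_cvg; first exact: continuous_expR.
  apply: cvgB; last first.
    under eq_fun do rewrite addrC expRD.
    exact: (cvgM (cvg_cst _) e0).
  apply: cvgN; apply: (@squeeze_cvgr _ _ _ _ (cst 0) (fun n => expR (- n.+1%:R))) => //.
    near=> n; rewrite expR_ge0/= argE ler_expR -mulrN1 ler_wpM2l//.
    (* This threshold gives N (x - a) <= -2, hence 1 + N (x - a) <= -1. *)
    have : 2 / (a - x) <= n.+1%:R.
      rewrite (@le_trans _ _ n%:R) ?ler_nat//.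
      by near: n; exact: nbhs_infty_ger.
    by rewrite ler_pdivrMr ?subr_gt0//; lra.
  exact: cvg_cst.
rewrite memNset/=; last by rewrite in_itv/= ltNge ax.
apply: (@squeeze_cvgr _ _ _ _ (cst 0) (fun n => expR (- n.+1%:R))) => //.
  near=> n; rewrite expR_ge0/= ler_expR argE.
  (* By e^t >= 1 + t and this sign, the first inner exponential is at least N; the second only makes
     the window smaller. *)
  have N0 : 0 <= n.+1%:R * (n.+1%:R * (x - a)) :> R by rewrite !mulr_ge0// subr_ge0.
  have := expR_ge1Dx (n.+1%:R * (1 + n.+1%:R * (x - a))).
  have := expR_ge0 (- n.+1%:R - x); lra.
exact: cvg_cst.
Unshelve. all: by end_near. Qed.

(** * Convergence of weak expectations and determinacy *)

Lemma cvg_schwartz_weak_expectation (R : realType) (phi : schwartzSpace R)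
    (f : R -> R) (fL1 : f \in Lfun (@lebesgue_measure R) 1%E)
    (a : R) (psi : nat -> schwartzSpace R) :
  (forall (n : nat) (x : R), 0 <= psi n x <= 1) ->
  (forall x : R, psi n x @[n --> \oo] --> (\1_`]-oo, a[ x : R)) ->
  schwartz_weak_expectation (regular_distribution fL1) phi (psi n)
    @[n --> \oo] --> weighted_cdf f phi a.
Proof.
move=> psi01 psi_cvg; have fphi := integrable_regular phi fL1.
have -> : weighted_cdf f phi a =
    \int[@lebesgue_measure R]_x (f x * (\1_`]-oo, a[ x * phi x)).
  (* [weighted_cdf] uses a closed half-line, the limit of the windows an open one; they differ by a
     null set. *)
  rewrite /weighted_cdf -Rintegral_itv_bndo_bndc; last first.
    exact: integrableS fphi.
  rewrite Rintegral_mkcond; apply: eq_Rintegral => x _.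
  by rewrite patch_indic/= mulrAC mulrA.
have fphi_dom n x : (`|(f x * (psi n x * phi x))%:E| <= `|f x * phi x|%:E)%E.
  have /andP[psi0 psi1] := psi01 n x.
  by rewrite lee_fin mulrCA normrM (ger0_norm psi0) ler_piMl.
have [|||||fphi1 _ int_cvg] := @dominated_convergence _ _ _ (@lebesgue_measure R)
  setT measurableT (fun n x => (f x * (psi n x * phi x))%:E)
  (fun x => (f x * (\1_`]-oo, a[ x * phi x))%:E) (fun x => `|f x * phi x|%:E).
- move=> n; pose g := SchwartzFun (schwartzM (schwartz_funP (psi n)) (schwartz_funP phi)).
  exact: (measurable_int _ (integrable_regular g fL1)).
(* The limit integrand contains an indicator, so, unlike the approximants, it is not of the form f
   times a Schwartz function. *)
- have fm : measurable_fun setT f.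
    have /Lfun1_integrable fi := fL1.
    by apply/measurable_EFinP; exact: (measurable_int (@lebesgue_measure R)).
  apply/measurable_EFinP; apply: measurable_funM => //.
  by apply: measurable_funM; [exact: measurable_indic|exact: schwartz_measurable].
- apply: aeW => x _; apply: cvg_EFin; first exact: nearW.
  exact: (cvgM (cvg_cst _) (cvgM (psi_cvg x) (cvg_cst _))).
- exact: integrable_norm.
- by apply: aeW => x n _; exact: fphi_dom.
- apply: fine_cvg; rewrite fineK//.
  exact: integrable_fin_num.
Qed.

Lemma weighted_cdf_inj (R : realType) (phi : schwartzSpace R) (f g : R -> R)
    (fL1 : f \in Lfun (@lebesgue_measure R) 1%E)
    (gL1 : g \in Lfun (@lebesgue_measure R) 1%E) :
  (forall psi : schwartzSpace R,
    schwartz_weak_expectation (regular_distribution fL1) phi psi =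
    schwartz_weak_expectation (regular_distribution gL1) phi psi) ->
  weighted_cdf f phi = weighted_cdf g phi.
Proof.
move=> fg; apply/funext => a.
have b0 n : 0 < n.+1%:R ^+ 2 :> R by rewrite exprn_gt0.
pose psi n := SchwartzFun
  (gumbel_window_schwartz (n.+1%:R * (1 - n.+1%:R * a)) (- n.+1%:R) (b0 n)).
have psi01 n x : 0 <= psi n x <= 1 by exact: gumbel_window_itv.
have psi_cvg x : psi n x @[n --> \oo] --> (\1_`]-oo, a[ x : R).
  exact: cvg_gumbel_window.
have f_cvg := cvg_schwartz_weak_expectation (phi := phi) fL1 psi01 psi_cvg.
have g_cvg := cvg_schwartz_weak_expectation (phi := phi) gL1 psi01 psi_cvg.
(* The two values at [a] are limits of one and the same real sequence. *)
have fgE : (fun n => schwartz_weak_expectation (regular_distribution fL1) phi (psi n)) =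
    (fun n => schwartz_weak_expectation (regular_distribution gL1) phi (psi n)).
  by apply/funext => n; exact: fg.
by rewrite fgE in f_cvg; exact: (cvg_unique _ f_cvg g_cvg).
Qed.

Theorem proposition2p12 (R : realType) (phi : schwartzSpace R)
    (phi_ge0 : forall x : R, 0 <= phi x) :
  (forall (f : R -> R) (fL1 : f \in Lfun (@lebesgue_measure R) 1%E)
      (f_ge0 : {ae @lebesgue_measure R, forall x : R, 0 <= f x})
      (a : R) (psi : nat -> schwartzSpace R),
    (forall (n : nat) (x : R), 0 <= psi n x <= 1) ->
    (forall x : R, psi n x @[n --> \oo] --> (\1_`]-oo, a[ x : R)) ->
    schwartz_weak_expectation (regular_distribution fL1) phi (psi n)
      @[n --> \oo] --> weighted_cdf f phi a) /\
  (forall (f g : R -> R)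
      (fL1 : f \in Lfun (@lebesgue_measure R) 1%E)
      (gL1 : g \in Lfun (@lebesgue_measure R) 1%E)
      (f_ge0 : {ae @lebesgue_measure R, forall x : R, 0 <= f x})
      (g_ge0 : {ae @lebesgue_measure R, forall x : R, 0 <= g x}),
    (forall psi : schwartzSpace R,
      schwartz_weak_expectation (regular_distribution fL1) phi psi =
      schwartz_weak_expectation (regular_distribution gL1) phi psi) ->
    weighted_cdf f phi = weighted_cdf g phi).
Proof.
split=> [f fL1 _ a psi|f g fL1 gL1 _ _].
  exact: cvg_schwartz_weak_expectation.
exact: weighted_cdf_inj.
Qed.
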